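(* Suppose $\theta<\kappa$ are cardinals with $\theta$ regular and uncountable, and suppose there is a normal $\theta$-covering matrix for $\kappa^+$. Then $\kappa^\theta>\kappa$.
   Context: For regular $\theta<\lambda$, a $\theta$-covering matrix for $\lambda$ is $\mathcal{D}=\langle D(i,\beta)\mid i<\theta,\beta<\lambda\rangle$ with $\beta=\bigcup_{i<\theta}D(i,\beta)$, $D(i,\beta)\subseteq D(j,\beta)$ for $i<j$, and for $\beta<\gamma<\lambda$, $i<\theta$ some $j<\theta$ with $D(i,\beta)\subseteq D(j,\gamma)$. $\beta_{\mathcal{D}}$ is the least $\beta$ such that $\mathrm{otp}(D(i,\gamma))<\beta$ for all $i<\theta,\gamma<\lambda$; $\mathcal{D}$ is normal if $\beta_{\mathcal{D}}<\lambda$. *)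

(* Defs.v *)
From mathcomp Require Import all_boot.
From mathcomp Require Import boolp classical_sets functions cardinality.

Set Implicit Arguments.
Unset Strict Implicit.
Unset Printing Implicit Defensive.

Local Open Scope classical_set_scope.
Local Open Scope card_scope.

(* Ordinals are represented by well-ordered types, to be compared only through
   [ord_eq], [ord_lt] and [ord_le]. The ordinals below [a] are represented by
   the elements of [a]: the element [x] stands for the order type of
   [below x]. *)
Record Ord := MkOrd {
  osort :> Type ;
  olt : osort -> osort -> Prop ;
  olt_wf : well_founded olt ;
  olt_trans : forall x y z, olt x y -> olt y z -> olt x z ;
  olt_total : forall x y, [\/ olt x y, x = y | olt y x]
}.

Definition below (a : Ord) (x : a) : set a := [set y | olt y x].

Section OrderType.
Variables (a : Ord) (A : set a).

Definition otp_lt (x y : A) : Prop := olt (set_val x) (set_val y).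

Lemma otp_lt_wf : well_founded otp_lt.
Proof.
move=> x; move: {2}(set_val x) (erefl (set_val x)) => v.
elim: v / (olt_wf v) x => v _ IH x xv; constructor => y yx.
by apply: (IH (set_val y)) => //; rewrite -xv.
Qed.

Lemma otp_lt_trans (x y z : A) : otp_lt x y -> otp_lt y z -> otp_lt x z.
Proof. exact: olt_trans. Qed.

Lemma otp_lt_total (x y : A) : [\/ otp_lt x y, x = y | otp_lt y x].
Proof.
case: (olt_total (set_val x) (set_val y)) => h; first exact: Or31.
- by apply: Or32; apply: val_inj.
- exact: Or33.
Qed.

Definition otp : Ord := MkOrd otp_lt_wf otp_lt_trans otp_lt_total.

End OrderType.

Definition ord_eq (a b : Ord) : Prop :=
  exists2 f : a -> b, bijective f & forall x y, olt x y <-> olt (f x) (f y).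

Definition ord_lt (a b : Ord) : Prop := exists x : b, ord_eq a (otp (below x)).

Definition ord_le (a b : Ord) : Prop := ord_lt a b \/ ord_eq a b.

(* Cardinals are initial ordinals. *)
Definition is_cardinal (a : Ord) : Prop :=
  forall b : Ord, ord_lt b a -> ~ ([set: b] #= [set: a]).

Definition is_succ_cardinal (k l : Ord) : Prop :=
  [/\ is_cardinal l, ord_lt k l &
      forall m : Ord, is_cardinal m -> ord_lt k m -> ord_le l m].

Definition has_cofinal_map (b a : Ord) : Prop :=
  exists f : b -> a, forall x : a, exists y : b, olt x (f y) \/ x = f y.

Definition is_cofinality (a b : Ord) : Prop :=
  has_cofinal_map b a /\
  forall c : Ord, has_cofinal_map c a -> ord_le b c.

Definition is_regular (a : Ord) : Prop :=
  [/\ is_cardinal a, infinite_set [set: a] & is_cofinality a a].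

Definition card_lt (T U : Type) (A : set T) (B : set U) : Prop :=
  A #<= B /\ ~ (B #<= A).

Section CoveringMatrix.
Variables (theta lambda : Ord) (D : theta -> lambda -> set lambda).

(* The set of ordinals below [beta] is [beta] itself, so the first clause says
   that beta is the union of the D(i, beta). *)
Definition covering_matrix : Prop :=
  [/\ forall beta : lambda, below beta = \bigcup_i D i beta,
      forall (i j : theta) (beta : lambda),
        olt i j -> D i beta `<=` D j beta &
      forall beta gamma : lambda, olt beta gamma ->
        forall i : theta, exists j : theta, D i beta `<=` D j gamma].

Definition matrix_bound (b : Ord) : Prop :=
  forall (i : theta) (gamma : lambda), ord_lt (otp (D i gamma)) b.

Definition is_beta_matrix (b : Ord) : Prop :=
  matrix_bound b /\ forall c : Ord, matrix_bound c -> ord_le b c.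

Definition normal_matrix : Prop :=
  exists2 b : Ord, is_beta_matrix b & ord_lt b lambda.

End CoveringMatrix.

(* Main.v *)
Require Import Defs.
From mathcomp Require Import all_boot.
From mathcomp Require Import boolp classical_sets functions cardinality.

Local Open Scope classical_set_scope.

(** Write [D(<i, gamma)] for the union of the [D(j, gamma)] with [j < i].  Given
    [beta < gamma], choose indices [i_0, i_1, ...] with [beta] in [D(i_0, gamma)]
    and [D(i_n, beta)] included in [D(i_(n+1), gamma)].  As [theta] is regular and
    uncountable, [i = sup_n (i_n + 1)] is below [theta], and
    [D(<i, beta) U {beta}] is included in [D(<i, gamma)].  Since [D(<i, beta)] lies
    below [beta], the order type of [D(<i, beta)] is strictly smaller than that of
    [D(<i, gamma)].  Hence the functions [i |-> otp D(<i, gamma)], for [gamma] below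
    [kappa^+], are pairwise distinct.  By normality they take values in an ordinal
    of cardinality at most [kappa], so [kappa^theta >= kappa^+]. *)

(** * Injections, well-orders and countable sequences *)

Lemma card_leTT_inj {T U : Type} :
  ([set: T] #<= [set: U])%card <-> exists f : T -> U, injective f.
Proof.
split=> [/card_leP[f]|[f f_inj]].
  exists (fun x => set_val (f (to_setT x))) => x y fxy.
  have /(inj : set_inj _ f) : f (to_setT x) = f (to_setT y) by exact: val_inj.
  rewrite !inE => /(_ I I) e.
  by have := congr1 set_val e.
apply/card_leP/injfunPex; exists (fun x => to_setT (f (set_val x))) => //.
move=> x y _ _ /(congr1 set_val) /= /f_inj; exact: val_inj.
Qed.

Lemma olt_irrefl (a : Ord) (x : a) : ~ olt x x.
Proof. by elim: (olt_wf x) => {}x _ IH x_lt; exact: (IH x x_lt x_lt). Qed.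

Lemma olt_min (a : Ord) (P : set a) :
  (exists x, P x) -> exists2 x, P x & forall y, olt y x -> ~ P y.
Proof.
move=> [x]; elim: (olt_wf x) => {}x _ IH Px.
case: (pselect (exists2 y, olt y x & P y)) => [[y yx Py]|nP]; first exact: IH Py.
by exists x => // y yx Py; apply: nP; exists y.
Qed.

Lemma olt_homo_expansive {a : Ord} {f : a -> a} :
  {homo f : x y / olt x y} -> forall x, ~ olt (f x) x.
Proof.
by move=> f_mono x; elim: (olt_wf x) => {}x _ IH fx; exact: (IH _ fx (f_mono _ _ fx)).
Qed.

Lemma ord_eq_inj {a b : Ord} : ord_eq a b -> exists f : a -> b, injective f.
Proof. by case=> f /bij_inj fi _; exists f. Qed.

Lemma ord_eq_inj_inv {a b : Ord} : ord_eq a b -> exists f : b -> a, injective f.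
Proof. by case=> f [g _ /can_inj gi] _; exists g. Qed.

Lemma ord_lt_homo {a b : Ord} : ord_lt a b ->
  exists2 f : a -> b, {homo f : x y / olt x y} & exists w, forall x, olt (f x) w.
Proof.
move=> [w [f _ f_mono]]; exists (fun x => set_val (f x)).
  by move=> x y /f_mono.
by exists w => x; exact: (set_valP (f x)).
Qed.

Lemma ord_le_homo {a b : Ord} : ord_le a b ->
  exists f : a -> b, {homo f : x y / olt x y}.
Proof.
by move=> [/ord_lt_homo[f f_mono _]|[f _ f_mono]]; exists f => // x y /f_mono.
Qed.

Lemma olt_homo_inj {a b : Ord} {f : a -> b} :
  {homo f : x y / olt x y} -> injective f.
Proof.
move=> f_mono x y fxy.
by case: (olt_total x y) => // /f_mono; rewrite fxy => /olt_irrefl.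
Qed.

(** Kept transparent so that the carrier reduces to [nat]. *)
Definition omega_ord : Ord.
Proof.
refine (@MkOrd nat (fun m n => m < n) _ _ _).
- by move=> n; elim/ltn_ind: n => n IH; constructor => m /IH.
- by move=> x y z; apply: ltn_trans.
- by move=> x y; case: (ltngtP x y) => h; [apply: Or31|apply: Or33|apply: Or32].
Defined.

(** Otherwise [u] is cofinal from [omega_ord], and minimality of the cofinality [theta] embeds
    [theta] into [nat]. *)
Lemma regular_uncountable_bounded {theta : Ord} :
  is_regular theta -> ~ countable [set: theta] ->
  forall u : nat -> theta, exists i, forall n, olt (u n) i.
Proof.
move=> [_ _ [_ theta_min]] theta_unc u; apply: contrapT => u_unb.
apply: theta_unc; apply/card_leTT_inj.
have [|f /olt_homo_inj f_inj] := @ord_le_homo theta omega_ord; last by exists f.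
apply: theta_min; exists u => x; apply: contrapT => x_ub.
apply: u_unb; exists x => n.
by case: (olt_total (u n) x) => // h; case: x_ub; exists n; [right|left].
Qed.

(** * Ordinals below a successor cardinal *)

Lemma otp_val_inj {a : Ord} {A : set a} : injective (fun x : otp A => set_val x).
Proof. by move=> x y; exact: val_inj. Qed.

Lemma below_inj {a : Ord} {x y : a} : olt x y \/ x = y ->
  exists f : otp (below x) -> otp (below y), injective f.
Proof.
case=> [xy|<-]; last by exists id.
have sub (z : otp (below x)) : set_val z \in below y.
  by rewrite inE; exact: (olt_trans (set_valP z) xy).
exists (fun z => SigSub (sub z)) => z1 z2 /(congr1 set_val) e; apply: otp_val_inj; exact: e.
Qed.

Lemma below_otp_inj {a : Ord} {A : set a} (w : otp A) :
  exists f : otp (below w) -> otp (below (set_val w)), injective f.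
Proof.
have sub (z : otp (below w)) : set_val (set_val z) \in below (set_val w).
  by rewrite inE; exact: (set_valP z).
exists (fun z => SigSub (sub z)) => z1 z2 /(congr1 set_val) e.
by apply: otp_val_inj; apply: otp_val_inj; exact: e.
Qed.

(** The least [y] whose segment receives an injection from [b] is a cardinal below [l], so it cannot
    exceed [k]. *)
Lemma ord_lt_succ_inj {k l b : Ord} : is_succ_cardinal k l -> ord_lt b l ->
  exists f : b -> k, injective f.
Proof.
move=> [_ [z kz] l_min] [x /ord_eq_inj[e e_inj]].
have [|y [g g_inj] y_min] := @olt_min l
    [set y | exists f : otp (below x) -> otp (below y), injective f].
  by exists x, id.
have y_card : is_cardinal (otp (below y)).
  (* A smaller equipotent [c] would carry the injection from [below x] into the segment of [w],
     against the choice of [y]. *)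
  move=> c [w /ord_eq_inj[h h_inj]] /card_eqPle[_ /card_leTT_inj[s s_inj]].
  have [t t_inj] := below_otp_inj w.
  apply: (y_min (set_val w)); first exact: (set_valP w).
  by exists (t \o h \o s \o g); do 3 apply: inj_comp => //.
have [k' k'_inj] := ord_eq_inj_inv kz.
have yz : olt y z \/ y = z.
  case: (olt_total y z) => [|->|zy]; [by left|by right|exfalso].
  have {}zy' : z \in below y by rewrite inE.
  have ky : ord_lt k (otp (below y)).
    (* The isomorphism [p] of [k] with [below z] is retyped into the segment of [z] inside
       [below y]. *)
    exists (SigSub zy'); case: kz => p [q pK qK] p_mono.
    have sub1 (v : k) : set_val (p v) \in below y.
      by rewrite inE; apply: olt_trans zy; exact: (set_valP (p v)).
    have sub2 (v : k) : (SigSub (sub1 v) : otp (below y)) \in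
        below (SigSub zy' : otp (below y)).
      by rewrite inE; exact: (set_valP (p v)).
    have subq (v : otp (below (SigSub zy' : otp (below y)))) :
        set_val (set_val v) \in below z.
      by rewrite inE; exact: (set_valP v).
    exists (fun v => SigSub (sub2 v)); last by move=> u v; apply: p_mono.
    exists (fun v => q (SigSub (subq v))).
      by move=> v; rewrite -[RHS]pK; congr q; apply: otp_val_inj.
    move=> v; apply: otp_val_inj; apply: otp_val_inj.
    exact: (congr1 set_val (qK (SigSub (subq v)))).
  have [f f_mono] := ord_le_homo (l_min _ y_card ky).
  (* Read as a self-map of [l], [f] is increasing yet sends [y] below itself. *)
  apply: (@olt_homo_expansive l (fun v => set_val (f v)) _ y).
    by move=> u v /f_mono.
  exact: (set_valP (f y)).
have [t t_inj] := below_inj yz.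
by exists (k' \o t \o g \o e); do 3 apply: inj_comp => //.
Qed.

(** * Order types bounded through increasing maps *)

Section EmbeddingBound.
Context {a b : Ord}.

(* [embeds_below A w] says that the order type of [A] is at most [w]; its least
   solution is thus [otp A], obtained without a collapsing map. *)
Definition embeds_below (A : set a) (w : b) : Prop :=
  exists e : a -> b, (forall x y, A x -> A y -> olt x y -> olt (e x) (e y)) /\
    (forall x, A x -> olt (e x) w).

Lemma embeds_below_subset {A B : set a} {w : b} :
  A `<=` B -> embeds_below B w -> embeds_below A w.
Proof.
move=> AB [e [e_mono e_lt]]; exists e.
by split=> [x y /AB Bx /AB By|x /AB]; [apply: e_mono|apply: e_lt].
Qed.

(** The map witnessing the bound for [B] also serves [A], with the image of [x] as the new bound. *)
Lemma embeds_below_cut {A B : set a} {x : a} {w : b} :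
  A `<=` below x -> A `<=` B -> B x -> embeds_below B w ->
  exists2 v, olt v w & embeds_below A v.
Proof.
move=> Ax AB Bx [e [e_mono e_lt]]; exists (e x); first exact: e_lt.
exists e; split=> [y z /AB By /AB Bz|y Ay]; first exact: e_mono.
by apply: e_mono => //; [apply: AB|apply: Ax].
Qed.

Lemma otp_embeds_below {A : set a} :
  ord_lt (otp A) b -> exists w, embeds_below A w.
Proof.
move=> /ord_lt_homo[f f_mono [w f_lt]]; exists w.
(* The value [w] outside [A] is a dummy. *)
pose e (x : a) :=
  if pselect (x \in A) is left xA then f (SigSub xA) else w.
have eE x (xA : x \in A) : e x = f (SigSub xA).
  by rewrite /e; case: pselect => // xA'; congr f; apply: val_inj.
exists e; split=> [x y /mem_set xA /mem_set yA xy|x /mem_set xA].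
  by rewrite !eE; apply: f_mono.
by rewrite eE.
Qed.

End EmbeddingBound.

(** * Coherence of the covering matrix *)

Definition initial_union {theta lambda : Ord} (D : theta -> lambda -> set lambda)
    (i : theta) (gamma : lambda) : set lambda :=
  \bigcup_(j in below i) D j gamma.

Section Coherence.
Context {theta lambda : Ord} {D : theta -> lambda -> set lambda}.
Context (D_cov : covering_matrix D).

Lemma initial_union_sub_below i gamma : initial_union D i gamma `<=` below gamma.
Proof. by case: D_cov => D_union _ _ x [j _ Dx]; rewrite D_union; exists j. Qed.

Lemma initial_union_sub i gamma : initial_union D i gamma `<=` D i gamma.
Proof. by case: D_cov => _ D_mono _ x [j /D_mono Dji /Dji]. Qed.

Lemma initial_union_coherent {beta gamma : lambda} :
  is_regular theta -> ~ countable [set: theta] -> olt beta gamma ->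
  exists i, initial_union D i beta `<=` initial_union D i gamma /\
    initial_union D i gamma beta.
Proof.
move=> theta_reg theta_unc bg; case: D_cov => D_union D_mono D_coh.
have [i0 _ Di0] : (\bigcup_i D i gamma) beta by rewrite -D_union.
have [s sP] := choice (D_coh _ _ bg).
pose u n := iter n s i0.
have [i u_lt i_min] := @olt_min theta [set i | forall n, olt (u n) i]
  (regular_uncountable_bounded theta_reg theta_unc u).
exists i; split; last by exists i0 => //; apply: (u_lt 0).
(* As [i] is the least strict bound of [u], some [u n] is at least [j]; one application of [s] then
   moves from [beta] to [gamma] while staying below [i]. *)
move=> x [j ji Dx]; have /existsNP[n un] := i_min _ ji.
exists (u n.+1); first exact: u_lt.
apply: (sP (u n)); case: (olt_total (u n) j) => [//|->//|/D_mono]; exact.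
Qed.

(** The value of [F] at [gamma] and [i] is the least bound on the order type of the initial union;
    coherence makes two rows differ at some [i]. *)
Lemma normal_matrix_inj {b : Ord} :
  is_regular theta -> ~ countable [set: theta] -> matrix_bound D b ->
  exists F : lambda -> theta -> b, injective F.
Proof.
move=> theta_reg theta_unc D_bound.
have least (p : lambda * theta) : exists w : b,
    embeds_below (initial_union D p.2 p.1) w /\
    forall v, olt v w -> ~ embeds_below (initial_union D p.2 p.1) v.
  case: p => gamma i /=.
  have [w0 w0P] := otp_embeds_below (D_bound i gamma).
  have [|w wP w_min] := @olt_min b (embeds_below (initial_union D i gamma)).
    by exists w0; apply: embeds_below_subset (initial_union_sub i gamma) w0P.
  by exists w.
have [R RP] := choice least.
exists (fun gamma i => R (gamma, i)).
have R_neq beta gamma : olt beta gamma ->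
    (fun i => R (beta, i)) = (fun i => R (gamma, i)) -> False.
  move=> /(initial_union_coherent theta_reg theta_unc)[i [sub mem]] Req.
  have [emb _] := RP (gamma, i).
  have [v v_lt v_emb] :=
    embeds_below_cut (initial_union_sub_below i beta) sub mem emb.
  have [_ /(_ v)] := RP (beta, i).
  by rewrite -[R (beta, i)]/((fun i => R (beta, i)) i) Req; apply.
move=> beta gamma e; case: (olt_total beta gamma) => // /R_neq; case=> //.
Qed.

End Coherence.

Theorem theorem5p8 (theta kappa kappa_plus : Ord)
    (theta_card : is_cardinal theta)
    (kappa_card : is_cardinal kappa)
    (theta_lt_kappa : ord_lt theta kappa)
    (theta_regular : is_regular theta)
    (theta_uncountable : ~ countable [set: theta])
    (kappa_plus_succ : is_succ_cardinal kappa kappa_plus)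
    (matrix : exists D : theta -> kappa_plus -> set kappa_plus,
      covering_matrix D /\ normal_matrix D) :
  card_lt [set: kappa] [set: theta -> kappa].
Proof.
have [kp_card kappa_lt _] := kappa_plus_succ.
have [D [D_cov [b [D_bound _] b_lt]]] := matrix.
have [F F_inj] := normal_matrix_inj D_cov theta_regular theta_uncountable D_bound.
have [g g_inj] := ord_lt_succ_inj kappa_plus_succ b_lt.
split.
  (* A point of [theta] is what separates distinct constant functions. *)
  have [i0] : exists i0 : theta, True.
    apply: contrapT => theta_empty; apply: theta_uncountable.
    apply/card_leTT_inj; exists (fun=> 0) => x.
    by case: theta_empty; exists x.
  move=> _; apply/card_leTT_inj; exists (fun x _ => x) => x y.
  by move=> /(congr1 (fun f => f i0)).
move=> /card_leTT_inj[h h_inj]; apply: (kp_card _ kappa_lt).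
have [f /olt_homo_inj f_inj _] := ord_lt_homo kappa_lt.
apply/card_eqPle; split; apply/card_leTT_inj; first by exists f.
(* The rows, moved from [b] into [kappa] by [g] and coded by [h], inject [kappa_plus] into
   [kappa]. *)
exists (fun x => h (g \o F x)) => x y /h_inj gF; apply: F_inj.
by apply: funext => i; apply: g_inj; have := congr1 (fun k => k i) gF.
Qed.
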